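(* For every integer $l\ge 1$, let $\mathcal{I}_6(l)$ be the index coding instance on $[4l+1]$ with side-information sets $A_{2i-1}=\{2j: j\in[2l]\setminus\{i\}\}\cup\{4l+1\}$ and $A_{2i}=\{2i-1\}$ for $i\in[2l]$, and $A_{4l+1}=\{2i-1: i\in[2l]\}$. Then $$\beta_{\text{R}}(\mathcal{I}_6(l))-\beta_{\text{UMCD}}(\mathcal{I}_6(l))=l-\tfrac{1}{2}.$$
   Context: An index coding instance consists of a positive integer $m$ and sets $A_i\subseteq[m]\setminus\{i\}$, $i\in[m]$; $B_i=[m]\setminus(A_i\cup\{i\})$. For a $0/1$ matrix $\boldsymbol{G}$ with columns indexed by $[m]$, $\boldsymbol{G}_{[k]}^{L}$ is the submatrix of its first $k$ rows and columns in $L$, and $\mathrm{mcm}(\boldsymbol{G})$ is the maximum number of $1$-entries no two in the same row or column (0 if there are no columns). UMCD algorithm: $N=[m]$, $k=0$; while $N\ne\emptyset$: $k\leftarrow k+1$; pick $w\in N$ minimizing $|A_w|$ over $N$ (arbitrary tie-breaking); set row $k$ of $\boldsymbol{G}$ to the indicator vector of $\{w\}\cup A_w$; remove $w$ from $N$; remove from $N$ every $i$ with $\mathrm{mcm}(\boldsymbol{G}_{[k]}^{\{i\}\cup B_i})=\mathrm{mcm}(\boldsymbol{G}_{[k]}^{B_i})+1$. Output $\beta_{\text{UMCD}}=k$ (the value is claimed for the executions of the algorithm). Recursive scheme: set $\beta_{\text{R}}(\{i\})=1$ for all $i$, and for $M\subseteq[m]$ with $|M|\ge2$ define recursively $$\beta_{\text{R}}(M)=\min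 \max_{i\in M}\sum_{j\in[n]:\,M_j\not\subseteq A_i}\gamma_j\,\beta_{\text{R}}(M_j),$$ the minimum being over finite families of nonempty proper subsets $M_1,\dots,M_n\subsetneq M$ and weights $\gamma_j\in[0,1]$ with $\sum_{j:\,i\in M_j}\gamma_j\ge1$ for all $i\in M$. Finally $\beta_{\text{R}}(\mathcal{I})=\beta_{\text{R}}([m])$. *)

(* Defs.v *)
From mathcomp Require Import all_boot all_order all_algebra.
From mathcomp Require Import reals.
Set Implicit Arguments. Unset Strict Implicit. Unset Printing Implicit Defensive.
Import Order.TTheory GRing.Theory Num.Theory.
Local Open Scope ring_scope.

(* Index coding instance on [m], elements encoded 0-based as 'I_m
   (element k of [m] is the ordinal k-1).  A : 'I_m -> {set 'I_m}. *)
Section IndexCoding.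
Variable m : nat.
Variable A : 'I_m -> {set 'I_m}.

Definition Bset (i : 'I_m) : {set 'I_m} := ~: (A i :|: [set i]).

(* rows : the k rows of G, each given by its support set; L : columns.
   A matching = set of (row, column) 1-entries, columns in L,
   no two in the same row or column. *)
Definition is_matching (rows : seq {set 'I_m}) (L : {set 'I_m})
    (S : {set 'I_(size rows) * 'I_m}) : bool :=
  [forall p in S, (p.2 \in L) && (p.2 \in nth set0 rows p.1)] &&
  [forall p in S, forall q in S, ((p.1 == q.1) || (p.2 == q.2)) ==> (p == q)].

Definition mcm (rows : seq {set 'I_m}) (L : {set 'I_m}) : nat :=
  \max_(S : {set 'I_(size rows) * 'I_m} | is_matching L S) #|S|.

Definition rows_of (ws : seq 'I_m) : seq {set 'I_m} :=
  [seq w |: A w | w <- ws].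

Definition decodes (ws : seq 'I_m) (i : 'I_m) : bool :=
  mcm (rows_of ws) (i |: Bset i) == (mcm (rows_of ws) (Bset i)).+1.

(* umcd_run N done rest : starting from the state (N, rows chosen so far
   = done), picking successively the elements of rest is a valid
   execution of the UMCD loop that terminates exactly when rest is exhausted. *)
Fixpoint umcd_run (N : {set 'I_m}) (done : seq 'I_m) (rest : seq 'I_m) : bool :=
  match rest with
  | [::] => N == set0
  | w :: rest' =>
      [&& N != set0, w \in N, [forall v in N, (#|A w| <= #|A v|)%N] &
        let ws' := rcons done w in
        umcd_run [set i in N :\ w | ~~ decodes ws' i] ws' rest']
  end.

(* ws is (the sequence of picks of) an execution of UMCD; its output is size ws *)
Definition UMCD_execution (ws : seq 'I_m) : bool := umcd_run [set: 'I_m] [::] ws.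

Variable R : realType.

Definition valid_family (M : {set 'I_m}) (F : seq ({set 'I_m} * R)) : Prop :=
  (forall p, p \in F -> [/\ p.1 != set0, p.1 \proper M & 0 <= p.2 <= 1]) /\
  (forall i, i \in M -> 1 <= \sum_(p <- F | i \in p.1) p.2).

Definition family_value (beta : {set 'I_m} -> R) (M : {set 'I_m})
    (F : seq ({set 'I_m} * R)) : R :=
  \big[Num.max/0]_(i in M) \sum_(p <- F | ~~ (p.1 \subset A i)) p.2 * beta p.1.

(* fuel-indexed recursion on the size of M; the fuel #|M| suffices since
   every M_j is a proper subset of M. *)
Fixpoint betaR_fuel (n : nat) (M : {set 'I_m}) : R :=
  match n with
  | 0 => 1
  | n'.+1 =>
      if (#|M| <= 1)%N then 1
      else inf (fun v : R => exists F, valid_family M F /\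
                             v = family_value (betaR_fuel n') M F)
  end.

Definition betaR (M : {set 'I_m}) : R := betaR_fuel #|M| M.
Definition betaR_instance : R := betaR [set: 'I_m].

End IndexCoding.

(* The instance I_6(l) on [4l+1]; for x : 'I_(4l+1), n := x+1 is the
   1-based element. *)
Definition A6 (l : nat) (x : 'I_(4 * l + 1)) : {set 'I_(4 * l + 1)} :=
  let n := x.+1 in
  if n == 4 * l + 1 then [set y : 'I_(4 * l + 1) | odd y.+1 && (y.+1 <= 4 * l)%N]
  else if odd n then
    [set y : 'I_(4 * l + 1) | ~~ odd y.+1 && (y.+1 != n.+1)]
      :|: [set y : 'I_(4 * l + 1) | y.+1 == 4 * l + 1]
  else [set y : 'I_(4 * l + 1) | y.+1 == n.-1].
Arguments A6 l x : clear implicits.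

(* Main.v *)
Require Import Defs.
From mathcomp Require Import all_boot all_order all_algebra.
From mathcomp Require Import reals zify ring lra.
Import Order.TTheory GRing.Theory Num.Theory.
Local Open Scope ring_scope.

(** Write x_i, y_i (i < 2l) and z for the odd, even and last elements of
    [4l+1]: y_i knows x_i, x_i knows z and every y_j with j <> i, and z knows
    every x_i.  In the 0-based encoding the y_i are exactly the odd ordinals.

    UMCD must first pick all the y_i, whose side information has size 1; no
    further element gets decoded meanwhile.  Whichever element it picks next,
    the 2l+1 rows saturate the 2l+1 columns of every remaining element together
    with its interfering elements, so everything is decoded and the output is
    2l+1.

    The recursive value is 3l+1/2.  From above, use l-1 directed 4-cycles
    x_a y_b x_b y_a (value 3 each), and on a last such cycle together with z
    the half-weighted cycle, edges x_a z and x_b z and singletons y_a, y_b.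
    From below, price every y_i at 1 and x_i, z at 1/2.  By induction every set
    costs at least its price: average over two receivers for which at most one
    set of the family is free, a distinct singleton of price 1/2 for each, so
    that the other receiver pays 1 for it. *)

(** * Matchings in the coding matrix and the decoding test *)

Section Matchings.
Context {m : nat} (A : 'I_m -> {set 'I_m}).

Lemma matchingP rows (L : {set 'I_m})
    (S : {set 'I_(size rows) * 'I_m}) : reflect
  ((forall p, p \in S -> p.2 \in L /\ p.2 \in nth set0 rows p.1) /\
   {in S &, forall p q, p.1 = q.1 \/ p.2 = q.2 -> p = q})
  (@is_matching m rows L S).
Proof.
apply: (iffP andP) => -[h1 h2]; split.
- by move=> p pS; apply/andP/(implyP (forallP h1 p)).
- move=> p q pS qS pq; apply/eqP.
  have /implyP -> // := forall_inP (forall_inP h2 p pS) q qS.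
  by case: pq => ->; rewrite eqxx ?orbT.
- by apply/forall_inP => p /h1[-> ->].
- apply/forall_inP => p pS; apply/forall_inP => q qS.
  by apply/implyP => /orP[] /eqP pq; apply/eqP/h2 => //; [left|right].
Qed.

Lemma mcm_le_rows rows (L : {set 'I_m}) : (mcm rows L <= size rows)%N.
Proof.
apply/bigmax_leqP => S /matchingP[_ S_inj].
rewrite -(@card_in_imset _ _ fst S); last first.
  by move=> p q pS qS pq; apply: S_inj => //; left.
by rewrite -[leqRHS]card_ord max_card.
Qed.

Lemma mcm_le_cols rows (L : {set 'I_m}) : (mcm rows L <= #|L|)%N.
Proof.
apply/bigmax_leqP => S /matchingP[SL S_inj].
rewrite -(@card_in_imset _ _ snd S); last first.
  by move=> p q pS qS pq; apply: S_inj => //; right.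
by apply: subset_leq_card; apply/subsetP => _ /imsetP[p /SL[pL _] ->].
Qed.

(** A matching has at most one entry in column [v]; deleting it leaves a matching inside [L]. *)
Lemma mcmU1_le rows v (L : {set 'I_m}) : (mcm rows (v |: L) <= (mcm rows L).+1)%N.
Proof.
apply/bigmax_leqP => S /matchingP[SL S_inj].
rewrite -(cardsID [set p | p.2 == v] S) -add1n leq_add //.
  apply/card_le1_eqP => p q; rewrite !inE.
  move=> /andP[pS /eqP pv] /andP[qS /eqP qv]; by apply: S_inj => //; right; rewrite pv.
apply: leq_bigmax_cond; apply/matchingP; split=> [p|p q] /setDP[pS].
  rewrite inE => pv; have [/setU1P[pv'|//] pr] := SL p pS.
  by rewrite pv' eqxx in pv.
by move=> _=> /setDP[qS _]; apply: S_inj.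
Qed.

Lemma mcm_zero_col (rows : seq {set 'I_m}) v (L : {set 'I_m}) :
  (forall r, r \in rows -> v \notin r) -> mcm rows (v |: L) = mcm rows L.
Proof.
move=> v0; apply: eq_bigl => S; apply/matchingP/matchingP => -[SL S_inj]; split=> // p pS.
  have [/setU1P[pv|//] pr] := SL p pS.
  by have := v0 _ (mem_nth set0 (ltn_ord p.1)); rewrite -pv pr.
by have [pL pr] := SL p pS; rewrite inE pL orbT.
Qed.

(** Lower bounds on [mcm] come from explicit matchings indexed by [T]: the entry of [t] lies in the
    row of the pick [g t] and in column [f t]. Naming rows by their picks avoids arithmetic on row
    numbers. *)
Lemma mcm_ge (T : finType) (g f : T -> 'I_m) ws (L : {set 'I_m}) :
  injective g -> injective f -> (forall t, g t \in ws) ->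
  (forall t, f t \in L /\ f t \in g t |: A (g t)) ->
  (#|T| <= mcm (rows_of A ws) L)%N.
Proof.
move=> g_inj f_inj gws fL.
have rP t : (index (g t) ws < size (rows_of A ws))%N.
  by rewrite size_map index_mem.
pose h t := (Ordinal (rP t), f t).
have h_inj : injective h by move=> s t [_ /f_inj].
rewrite -cardsT -(card_imset _ h_inj); apply: leq_bigmax_cond.
apply/matchingP; split=> [_ /imsetP[t _ ->]|_ _ /imsetP[s _ ->] /imsetP[t _ ->]] /=.
  have [fLt fA] := fL t; split=> //.
  by rewrite (nth_map (g t)) ?index_mem // nth_index.
case=> [[gst]|/f_inj -> //]; congr h; apply: g_inj.
by rewrite -(nth_index (g s) (gws s)) gst nth_index.
Qed.

(** The interfering columns alone carry at most [#|Bset A v|] entries and one more column adds at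
    most one, so saturating all the columns makes the two matching numbers differ by exactly one. *)
Lemma decodes_tight ws v :
  (#|Bset A v| < mcm (rows_of A ws) (v |: Bset A v))%N -> decodes A ws v.
Proof.
move=> h; rewrite /decodes eqn_leq mcmU1_le /=.
exact: leq_ltn_trans (mcm_le_cols _ _) h.
Qed.

(** Once the interfering columns use every row, column [v] finds no row for a further entry. *)
Lemma full_rows_not_decodes ws v :
  (size ws <= mcm (rows_of A ws) (Bset A v))%N -> ~~ decodes A ws v.
Proof.
move=> h; have := mcm_le_rows (rows_of A ws) (v |: Bset A v).
rewrite size_map => /leq_trans/(_ h) le_mcm.
by rewrite /decodes neq_ltn ltnS le_mcm.
Qed.

Lemma uncovered_not_decodes ws v :
  (forall w, w \in ws -> v \notin w |: A w) -> ~~ decodes A ws v.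
Proof.
move=> vws; rewrite /decodes mcm_zero_col; first by rewrite -[X in X == _]addn0 -addn1 eqn_add2l.
by move=> _ /mapP[w /vws ? ->].
Qed.

Lemma umcd_run_exists (N : {set 'I_m}) ws : exists rest, umcd_run A N ws rest.
Proof.
have [n] := ubnP #|N|; elim: n N ws => // n IHn N ws /ltnSE Nn.
have [->|/set0Pn[w0 Nw0]] := eqVneq N set0; first by exists [::]; apply: eqxx.
case: (arg_minnP (fun v => #|A v|) Nw0) => w Nw w_min.
pose ws' := rcons ws w.
have [|rest hrest] := IHn [set i in N :\ w | ~~ decodes A ws' i] ws'.
  (* The pick [w] leaves [N] in every round, whatever gets decoded, so [#|N|] drops. *)
  apply: leq_trans Nn; apply: (@leq_ltn_trans #|N :\ w|).
    by apply: subset_leq_card; apply/subsetP => i; rewrite inE => /andP[].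
  by rewrite [#|N|](cardsD1 w) (Nw : w \in N).
exists (w :: rest); apply/and4P; split=> //.
  by apply/set0Pn; exists w.
by apply/forall_inP.
Qed.

Lemma in_Bset (u v : 'I_m) : (v \in Bset A u) = (v \notin A u) && (v != u).
Proof. by rewrite !inE negb_or. Qed.

End Matchings.

(** * The recursive value as a linear program *)

Section BetaR.
Context {m : nat} (A : 'I_m -> {set 'I_m}) {R : realType}.
Implicit Types (M S : {set 'I_m}) (F : seq ({set 'I_m} * R)) (b : {set 'I_m} -> R).

Lemma bigmax_ge0 (I : Type) (r : seq I) (P : pred I) (f : I -> R) :
  0 <= \big[Num.max/0]_(i <- r | P i) f i.
Proof. elim/big_rec: _ => // i x _ x0; by rewrite le_max x0 orbT. Qed.

Lemma family_value_ge b M F i : i \in M ->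
  \sum_(p <- F | ~~ (p.1 \subset A i)) p.2 * b p.1 <= family_value A b M F.
Proof. by move=> iM; apply: le_bigmax_cond. Qed.

(* Weak duality for the linear program defining [betaR]: [u] prices the
   elements and the receivers [i1], [i2] are averaged with weight 1/2. *)
Lemma family_value_dual b M F (u : 'I_m -> R) i1 i2 :
  valid_family M F -> (forall e, 0 <= u e) -> i1 \in M -> i2 \in M ->
  (forall S, S != set0 -> S \proper M -> 2 * \sum_(e in S) u e <=
     ((~~ (S \subset A i1))%:R + (~~ (S \subset A i2))%:R) * b S) ->
  \sum_(e in M) u e <= family_value A b M F.
Proof.
move=> hF u0 i1M i2M u_le.
have [F_ok F_cover] := hF.
suff: 2 * \sum_(e in M) u e <=
    \sum_(p <- F | ~~ (p.1 \subset A i1)) p.2 * b p.1 +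
    \sum_(p <- F | ~~ (p.1 \subset A i2)) p.2 * b p.1.
  have := family_value_ge b M F i1 i1M; have := family_value_ge b M F i2 i2M; lra.
(* Twice the weighted price of the family separates the two sides: covering bounds it below, and
   [u_le], applied set by set, bounds it above. *)
apply: (@le_trans _ _ (2 * \sum_(p <- F) p.2 * \sum_(e in p.1) u e)).
  rewrite ler_pM2l //.
  apply: (@le_trans _ _ (\sum_(e in M) u e * \sum_(p <- F | e \in p.1) p.2)).
    by apply: ler_sum => e eM; rewrite ler_peMr ?F_cover.
  under eq_bigr do rewrite mulr_sumr.
  rewrite (exchange_big_dep predT) //= le_eqVlt; apply/orP; left; apply/eqP.
  rewrite big_seq [RHS]big_seq; apply: eq_bigr => p /F_ok[_ /proper_sub pM _].
  rewrite mulr_sumr; apply: eq_big => [e|e _]; last by rewrite mulrC.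
  by apply: andb_idl; apply: (subsetP pM).
rewrite [X in _ <= X + _]big_mkcond [X in _ <= _ + X]big_mkcond -big_split /=.
rewrite mulr_sumr big_seq [leRHS]big_seq; apply: ler_sum => p /F_ok[pN0 pM /andP[p0 _]].
have := ler_wpM2l p0 (u_le _ pN0 pM).
by do 2!case: ifP => _; rewrite /=; lra.
Qed.

Lemma betaR_fuel_card_le1 n M : (#|M| <= 1)%N -> betaR_fuel A R n M = 1.
Proof. by case: n => //= n ->. Qed.

Definition singletons M : seq ({set 'I_m} * R) := [seq ([set i], 1) | i <- enum M].

Lemma valid_singletons M : (1 < #|M|)%N -> valid_family M (singletons M).
Proof.
move=> M2; split=> [_ /mapP[i iM ->]|i iM] /=.
  rewrite mem_enum in iM; split; last by rewrite ler01 lexx.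
    by apply/set0Pn; exists i; rewrite inE.
  by rewrite properEcard sub1set iM cards1.
rewrite big_map big_enum_cond /= (bigD1 i) /=; last by rewrite iM inE eqxx.
by rewrite lerDl; apply: sumr_ge0.
Qed.

(** Bounding an [inf] from below requires some admissible value; the singletons provide one. *)
Lemma betaR_fuel_ge n M c : (1 < #|M|)%N ->
  (forall F, valid_family M F -> c <= family_value A (betaR_fuel A R n) M F) ->
  c <= betaR_fuel A R n.+1 M.
Proof.
move=> M2 c_le /=; rewrite leqNgt M2 /=; apply: lb_le_inf.
  by eexists; exists (singletons M); split; first exact: valid_singletons.
by move=> _ [F [hF ->]]; apply: c_le.
Qed.

Lemma betaR_fuel_le n M F : (1 < #|M|)%N -> valid_family M F ->
  betaR_fuel A R n.+1 M <= family_value A (betaR_fuel A R n) M F.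
Proof.
move=> M2 hF /=; rewrite leqNgt M2 /=; apply: ge_inf; last by exists F.
by exists 0 => _ [G [_ ->]]; apply: bigmax_ge0.
Qed.

Lemma betaR_fuel_ge0 n M : 0 <= betaR_fuel A R n M.
Proof.
have [M1|M2] := leqP #|M| 1; first by rewrite betaR_fuel_card_le1 ?ler01.
case: n => [|n]; first exact: ler01.
by apply: betaR_fuel_ge => // F _; apply: bigmax_ge0.
Qed.

(** All terms are nonnegative, so a receiver may also be charged for the sets it already knows. *)
Lemma betaR_fuel_le_total n M F : (1 < #|M|)%N -> valid_family M F ->
  betaR_fuel A R n.+1 M <= \sum_(p <- F) p.2 * betaR_fuel A R n p.1.
Proof.
move=> M2 hF; have [F_ok _] := hF.
apply: le_trans (betaR_fuel_le n _ _ M2 hF) _.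
have F0 p : p \in F -> 0 <= p.2 * betaR_fuel A R n p.1.
  by move=> /F_ok[_ _ /andP[p0 _]]; rewrite mulr_ge0 ?betaR_fuel_ge0.
apply: bigmax_le => [|i _]; first by rewrite big_seq sumr_ge0.
rewrite big_mkcond /= big_seq [leRHS]big_seq; apply: ler_sum => p pF.
by case: ifP => // _; apply: F0.
Qed.

(* Every receiver of [M] knows another element of [M], so sending the elements
   of [M] one by one costs it at most [#|M| - 1]. *)
Lemma betaR_fuel_le_pred n M : (1 < #|M|)%N ->
  (forall i, i \in M -> exists2 j, j \in M & j \in A i) ->
  betaR_fuel A R n.+1 M <= #|M|%:R - 1.
Proof.
move=> M2 M_knows; apply: le_trans (betaR_fuel_le n _ _ M2 (valid_singletons _ M2)) _.
apply: bigmax_le => [|i iM]; first by rewrite subr_ge0 ler1n ltnW.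
have [j jM jA] := M_knows i iM.
rewrite big_map big_enum_cond /=.
under eq_bigr do rewrite betaR_fuel_card_le1 ?cards1 // mulr1.
rewrite sumr_const lerBrDr -[X in _ + X <= _]/(1%:R) -natrD ler_nat addn1.
rewrite [#|M|](cardsD1 j) jM add1n ltnS.
apply: subset_leq_card; apply/subsetP => k; rewrite !inE unfold_in /= sub1set => /andP[kM kA].
by rewrite kM andbT; apply: contraNneq kA => ->.
Qed.

(* At most one set escapes each of the two receivers, and it is then a
   singleton of price 1/2, for which the other receiver pays. *)
Lemma betaR_fuel_dual_half n M (u : 'I_m -> R) i1 i2 e1 e2 :
  (1 < #|M|)%N -> (forall e, 0 <= u e <= 1) -> i1 \in M -> i2 \in M ->
  e1 != e2 -> u e1 = 2^-1 -> u e2 = 2^-1 ->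
  (forall e, e \in M -> e \in A i1 -> e = e1) ->
  (forall e, e \in M -> e \in A i2 -> e = e2) ->
  (forall S, S != set0 -> S \proper M -> \sum_(e in S) u e <= betaR_fuel A R n S) ->
  \sum_(e in M) u e <= betaR_fuel A R n.+1 M.
Proof.
move=> M2 u01 i1M i2M e12 u1 u2 A1 A2 IH; apply: betaR_fuel_ge => // F hF.
apply: (family_value_dual _ _ _ _ i1 i2) => // [e|S S0 SM]; first by case/andP: (u01 e).
have IHS := IH S S0 SM.
have sub1 i e : (forall x, x \in M -> x \in A i -> x = e) -> S \subset A i -> S = [set e].
  move=> Ai SA; apply/eqP; rewrite eqEsubset sub1set andbC.
  have Se x : x \in S -> x = e.
    by move=> xS; apply: Ai; [apply: (subsetP (proper_sub SM))|apply: (subsetP SA)].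
  apply/andP; split; last by apply/subsetP => x /Se ->; rewrite inE.
  by have /set0Pn[x xS] := S0; rewrite -(Se x xS).
have [S1|_] := boolP (S \subset A i1); have [S2|_] := boolP (S \subset A i2).
(* Were both receivers exempt, [S] would be [[set e1]] and [[set e2]] at once. *)
- have /setP/(_ e1) := sub1 _ _ A2 S2; rewrite (sub1 _ _ A1 S1) !inE eqxx.
  by rewrite (negPf e12).
- by rewrite (sub1 _ _ A1 S1) big_set1 u1 betaR_fuel_card_le1 ?cards1 //=; lra.
- by rewrite (sub1 _ _ A2 S2) big_set1 u2 betaR_fuel_card_le1 ?cards1 //=; lra.
- by rewrite /=; lra.
Qed.

End BetaR.

(** * Vertices and side information of the instance *)

Section InstanceI6.
Context {l : nat}.
Implicit Types (i j : 'I_(2 * l)) (v w : 'I_(4 * l + 1)) (M : {set 'I_(4 * l + 1)}).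
Implicit Type ds : seq 'I_(2 * l).

Fact vx_subproof i : (2 * i < 4 * l + 1)%N. Proof. have := ltn_ord i; lia. Qed.
Fact vy_subproof i : (2 * i + 1 < 4 * l + 1)%N.
Proof. have := ltn_ord i; lia. Qed.
Fact vz_subproof : (4 * l < 4 * l + 1)%N. Proof. lia. Qed.

Definition vx i := Ordinal (vx_subproof i).
Definition vy i := Ordinal (vy_subproof i).
Definition vz := Ordinal vz_subproof.

Lemma vx_inj : injective vx.
Proof. by move=> i j /(congr1 val) /= ?; apply: val_inj => /=; lia. Qed.

Lemma vy_inj : injective vy.
Proof. by move=> i j /(congr1 val) /= ?; apply: val_inj => /=; lia. Qed.

Variant vertex_spec : 'I_(4 * l + 1) -> Type :=
  | VertexX i : vertex_spec (vx i)
  | VertexY i : vertex_spec (vy i)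
  | VertexZ : vertex_spec vz.

Lemma vertexP v : vertex_spec v.
Proof.
have hv := ltn_ord v; have [v4l|v4l] := eqVneq (v : nat) (4 * l)%N.
  by have -> : v = vz; [apply: val_inj | constructor].
have hi : (v./2 < 2 * l)%N by lia.
have [vo|vo] := boolP (odd v).
  have -> : v = vy (Ordinal hi); [apply: val_inj => /=; lia | constructor].
have -> : v = vx (Ordinal hi); [apply: val_inj => /=; lia | constructor].
Qed.

Lemma vxy i j : (vx i == vy j) = false.
Proof. by rewrite -val_eqE /=; lia. Qed.
Lemma vyx i j : (vy i == vx j) = false.
Proof. by rewrite -val_eqE /=; lia. Qed.
Lemma vxz i : (vx i == vz) = false.
Proof. by rewrite -val_eqE /=; have := ltn_ord i; lia. Qed.
Lemma vzx i : (vz == vx i) = false.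
Proof. by rewrite eq_sym vxz. Qed.
Lemma vyz i : (vy i == vz) = false.
Proof. by rewrite -val_eqE /=; lia. Qed.
Lemma vzy i : (vz == vy i) = false.
Proof. by rewrite eq_sym vyz. Qed.

Definition vertex_neqE :=
  (vxy, vyx, vxz, vzx, vyz, vzy, inj_eq vx_inj, inj_eq vy_inj).

Lemma in_A6 v w : w \in A6 l v =
  if v == vz then (w < 4 * l)%N && ~~ odd w
  else if odd v then (w == v.-1 :> nat)%N
  else (w == vz) || odd w && (w != v.+1 :> nat).
Proof.
have eqz (u : nat) : (u.+1 == 4 * l + 1)%N = (u == 4 * l)%N by lia.
(* In [A6] this bound is read in ring scope, over the semiring of natural numbers; the conversion
   makes it plain arithmetic. *)
rewrite /A6 -[(4 * l + 1)%R]/(4 * l + 1)%N -!val_eqE /= eqz.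
case: eqP => [_|/eqP vl]; first by rewrite inE /=; lia.
rewrite if_neg; case: ifP => vo; rewrite !inE /= ?eqSS ?negbK; first by lia.
by rewrite orbC; congr orb; apply: eqz.
Qed.

Lemma A6z : A6 l vz = [set vx i | i in 'I_(2 * l)].
Proof.
apply/setP=> v; rewrite in_A6 eqxx.
case: (vertexP v) => [i|i|].
- by rewrite imset_f //=; have := ltn_ord i; lia.
- transitivity false; first by rewrite /=; lia.
  by apply/esym/imsetP => -[j _ /eqP]; rewrite vertex_neqE.
- by rewrite ltnn /=; apply/esym/imsetP => -[j _ /eqP]; rewrite vertex_neqE.
Qed.

Lemma A6y i : A6 l (vy i) = [set vx i].
Proof.
apply/setP=> v; rewrite in_A6 inE vertex_neqE -[RHS]val_eqE /=.
by case: ifP; have := ltn_ord i; lia.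
Qed.

Lemma A6x i : A6 l (vx i) = vz |: [set vy j | j in [set~ i]].
Proof.
apply/setP=> v; rewrite in_A6 !inE vertex_neqE /=.
case: ifP => [|_]; first by lia.
case: (vertexP v) => [j|j|]; rewrite ?eqxx ?vertex_neqE //=.
- have -> : odd (2 * j) = false by lia.
  by apply/esym/imsetP => -[k _ /eqP]; rewrite vertex_neqE.
- rewrite mem_imset; last exact: vy_inj.
  by rewrite !inE -[in RHS]val_eqE /=; lia.
Qed.

Lemma card_A6z : #|A6 l vz| = (2 * l)%N.
Proof. by rewrite A6z card_imset ?card_ord //; apply: vx_inj. Qed.

Lemma card_A6y i : #|A6 l (vy i)| = 1%N.
Proof. by rewrite A6y cards1. Qed.

Lemma card_A6x i : #|A6 l (vx i)| = (2 * l)%N.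
Proof.
rewrite A6x cardsU1 card_imset; last exact: vy_inj.
rewrite cardsC1 card_ord.
case: imsetP => [[j _ /eqP]|_]; first by rewrite vertex_neqE.
by have := ltn_ord i; rewrite /=; lia.
Qed.

Lemma vx_in_A6x i j : (vx i \in A6 l (vx j)) = false.
Proof.
rewrite A6x !inE vertex_neqE /=.
by apply/imsetP => -[k _ /eqP]; rewrite vertex_neqE.
Qed.

Lemma vy_in_A6x i j : (vy i \in A6 l (vx j)) = (i != j).
Proof. by rewrite A6x !inE vertex_neqE (mem_imset _ _ (vy_inj)) !inE. Qed.

Lemma vz_in_A6x j : vz \in A6 l (vx j).
Proof. by rewrite A6x setU11. Qed.

Lemma vx_in_A6z i : vx i \in A6 l vz.
Proof. by rewrite A6z imset_f. Qed.

Lemma vy_in_A6z i : (vy i \in A6 l vz) = false.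
Proof.
by rewrite A6z; apply/imsetP => -[k _ /eqP]; rewrite vertex_neqE.
Qed.

Lemma vz_in_A6z : (vz \in A6 l vz) = false.
Proof.
by rewrite A6z; apply/imsetP => -[k _ /eqP]; rewrite vertex_neqE.
Qed.

Lemma vx_in_A6y i j : (vx i \in A6 l (vy j)) = (i == j).
Proof. by rewrite A6y inE vertex_neqE. Qed.

Lemma vy_in_A6y i j : (vy i \in A6 l (vy j)) = false.
Proof. by rewrite A6y inE vertex_neqE. Qed.

Lemma vz_in_A6y j : (vz \in A6 l (vy j)) = false.
Proof. by rewrite A6y inE vertex_neqE. Qed.

Definition in_A6E := (vx_in_A6x, vy_in_A6x, vz_in_A6x, vx_in_A6y, vy_in_A6y,
  vz_in_A6y, vx_in_A6z, vy_in_A6z, vz_in_A6z).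

(** * The executions of UMCD *)

Lemma card_Bset_A6 v : ~~ odd v -> #|Bset (A6 l) v| = (2 * l)%N.
Proof.
move=> v_even; have cardA : #|A6 l v| = (2 * l)%N.
  by move: v_even; case: (vertexP v) => [i _|i|_]; rewrite ?card_A6x ?card_A6z //=; lia.
have vA : v \notin A6 l v.
  by move: v_even; case: (vertexP v) => [i|i|] _; rewrite in_A6E ?eqxx.
have := cardsC (A6 l v :|: [set v]).
rewrite setUC cardsU1 vA cardA card_ord /Bset setUC; lia.
Qed.

(** For x_j, all rows are matched inside its interfering columns: row y_i takes x_i, except that row
    y_j, if present, takes y_j. For z and for a y_j not yet picked, column [v] is zero. *)
Lemma y_rows_not_decodes ds v :
  uniq ds -> v \notin map vy ds -> ~~ decodes (A6 l) (map vy ds) v.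
Proof.
move=> ds_uniq; case: (vertexP v) => [j _|j|_].
- apply: full_rows_not_decodes; rewrite size_map -[leqLHS]card_ord.
  pose d := tnth (in_tuple ds).
  have d_inj : injective d by apply/tuple_uniqP.
  apply: (@mcm_ge _ _ _ (vy \o d) (fun t => if d t == j then vy j else vx (d t))).
  + exact: inj_comp (vy_inj) d_inj.
  + move=> s t; case: eqP => [ds_j|_]; case: eqP => [dt_j|_] /eqP; rewrite vertex_neqE //.
      by move=> _; apply: d_inj; rewrite ds_j.
    by move=> /eqP/d_inj.
  + by move=> t; rewrite /= map_f //; apply: mem_tnth.
  + move=> t; rewrite /= !in_Bset !in_setU1.
    by case: eqP => [->|/eqP dj]; rewrite !in_A6E ?vertex_neqE ?eqxx ?dj.
- rewrite (mem_map (vy_inj)) => jds; apply: uncovered_not_decodes.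
  move=> _ /mapP[i ids ->]; rewrite in_setU1 in_A6E vertex_neqE orbF.
  by apply: contraNneq jds => ->.
- apply: uncovered_not_decodes => _ /mapP[i _ ->].
  by rewrite in_setU1 in_A6E vertex_neqE.
Qed.

(** Both [v] and [w] are among the x_i and z. The 2l+1 columns of [v |: Bset (A6 l) v] are matched
    perfectly with the rows of the y_i ([Some i]) and of [w] ([None]). *)
Lemma last_row_decodes ds v w : (forall i, i \in ds) ->
  ~~ odd v -> ~~ odd w -> v != w -> decodes (A6 l) (rcons (map vy ds) w) v.
Proof.
move=> ds_all v_even w_even vw; apply: decodes_tight.
have cardT : #|{: option 'I_(2 * l)}| = (2 * l).+1 by rewrite card_option card_ord.
rewrite card_Bset_A6 // -cardT.
pose g t := oapp vy w t.
have g_inj : injective g.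
  have wy i : vy i != w by apply: contraNneq w_even => <- /=; lia.
  move=> [i|] [j|] //= /eqP; last by rewrite eq_sym (negPf (wy _)).
    by rewrite vertex_neqE => /eqP ->.
  by rewrite (negPf (wy _)).
have g_in t : g t \in rcons (map vy ds) w.
  by rewrite mem_rcons inE; case: t => [i|] /=; rewrite ?eqxx // map_f ?orbT.
move: v_even w_even vw g_inj g_in; rewrite {}/g.
case: (vertexP v) => [j|j|] /= v_even; [|by lia|].
- case: (vertexP w) => [k|k|] /= w_even; [|by lia|].
  + rewrite vertex_neqE => jk g_inj g_in.
    (* The columns are y_j and all x_i: row y_i takes x_i, and row x_k takes y_j, which x_k knows
       since [k] differs from [j]. *)
    refine (@mcm_ge _ _ _ _ (oapp vx (vy j)) _ _ g_inj _ g_in _).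
      by move=> [s|] [t|] //= /eqP; rewrite vertex_neqE // => /eqP ->.
    by move=> [t|] /=; rewrite !in_setU1 !in_Bset !in_A6E ?vertex_neqE ?eqxx ?jk ?orbT //= orbN.
  + move=> _ g_inj g_in.
    (* Now row y_j takes y_j, which frees column x_j for the row of z. *)
    refine (@mcm_ge _ _ _ _ (oapp (fun i => if i == j then vy i else vx i) (vx j)) _ _ g_inj _ g_in _).
      by move=> [s|] [t|] //=; do ?case: eqP => ? //; move=> /eqP; rewrite vertex_neqE // => /eqP; congruence.
    move=> [t|] /=; rewrite !in_setU1 !in_Bset ?in_A6E ?eqxx ?orbT //.
    by case: (eqVneq t j) => [->|tj]; rewrite ?in_A6E ?vertex_neqE ?tj ?eqxx ?orbT.
- case: (vertexP w) => [k|k|] /= w_even; [|by lia|by rewrite eqxx].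
  move=> _ g_inj g_in.
  (* The columns are z and all y_i: row y_i takes y_i, and row x_k takes z. *)
  refine (@mcm_ge _ _ _ _ (oapp vy vz) _ _ g_inj _ g_in _).
    by move=> [s|] [t|] //= /eqP; rewrite vertex_neqE // => /eqP ->.
  by move=> [t|] /=; rewrite !in_setU1 !in_Bset !in_A6E ?vertex_neqE ?eqxx ?orbT.
Qed.

Lemma UMCD_A6_size ws : (0 < l)%N -> UMCD_execution (A6 l) ws -> size ws = (2 * l + 1)%N.
Proof.
move=> l_gt0; rewrite /UMCD_execution.
have -> : [set: 'I_(4 * l + 1)] = ~: [set v in map vy [::]].
  by apply/setP=> v; rewrite !inE.
(* Invariant while some y_i is left: the picks are exactly [map vy ds], and nothing else has been
   removed. *)
suff run ds : uniq ds ->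
    umcd_run (A6 l) (~: [set v in map vy ds]) (map vy ds) ws ->
    (size ds + size ws = 2 * l + 1)%N by apply: (run [::]).
elim: ws ds => [|w ws IHws] ds ds_uniq /=.
  move=> /eqP/setP/(_ vz); rewrite !inE => /negbFE/mapP[i _ /eqP].
  by rewrite vertex_neqE.
move=> /and4P[_ w_new /forall_inP w_min].
have [ds_all|] := boolP [forall i, i \in ds].
  have even_new v : v \in ~: [set v in map vy ds] -> ~~ odd v.
    case: (vertexP v) => [i|i|] /=; rewrite ?inE; [by lia| |by lia].
    by rewrite map_f //; apply: (forallP ds_all).
  have -> : [set i in ~: [set v in map vy ds] :\ w |
      ~~ decodes (A6 l) (rcons (map vy ds) w) i] = set0; last first.
    case: ws {IHws} => [_|? ? /andP[/eqP//]].
    have cardds : #|ds| = (2 * l)%N.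
      by rewrite -[RHS]card_ord; apply: eq_card => i; rewrite (forallP ds_all).
    by rewrite -[X in (_ = X + _)%N]cardds (card_uniqP ds_uniq).
  apply/setP=> v; rewrite inE in_set0 in_setD1; apply/negbTE.
  apply/negP => /andP[/andP[vw v_new]] /negP; apply.
  by apply: last_row_decodes (forallP ds_all) (even_new _ v_new) (even_new _ w_new) vw.
(* A remaining y_i has side information of size 1, below the size 2l of every x_j and of z, so the
   pick is again some y_j. *)
move=> /forallPn[i ids].
have [j wj] : exists j, w = vy j.
  have /w_min : vy i \in ~: [set v in map vy ds].
    by rewrite !inE (mem_map (vy_inj)).
  case: (vertexP w) => [j|j|]; rewrite ?card_A6x ?card_A6z ?card_A6y; try lia.
  by exists j.
rewrite {w}wj in w_new w_min *; rewrite -map_rcons => run.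
have jds : j \notin ds by move: w_new; rewrite !inE (mem_map (vy_inj)).
have rcons_uniq : uniq (rcons ds j) by rewrite rcons_uniq jds.
rewrite addnS -addSn -(size_rcons ds j); apply: IHws => //.
apply: etrans run; congr umcd_run; apply/setP=> v.
rewrite in_set in_setD1 !in_setC !in_set map_rcons mem_rcons inE negb_or -map_rcons.
case: eqVneq => //= vj; apply/idP/andP => [vds|[]//]; split=> //.
apply: y_rows_not_decodes => //.
by rewrite map_rcons mem_rcons inE negb_or vj.
Qed.

(** * Lower bound on the recursive value *)

Context {R : realType}.
Local Notation beta := (betaR_fuel (A6 l) R).

Definition price v : R := if odd v then 1 else 2^-1.

Definition is_x v : bool := ~~ odd v && (v != vz).

(* The vertices [vx i] know nothing about each other. *)
Lemma card_x_le_betaR n M : M != set0 -> (#|M| <= n)%N ->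
  \sum_(v in M) (is_x v)%:R <= beta n M.
Proof.
elim: n M => [|n IHn] M M0 Mn; first by rewrite -cards_eq0 -leqn0 Mn in M0.
have [M1|M2] := leqP #|M| 1.
  rewrite betaR_fuel_card_le1 //; have /cards1P[v ->] : #|M| == 1%N.
    by rewrite eqn_leq M1 card_gt0.
  by rewrite big_set1 lern1 leq_b1.
have [/existsP[v /andP[vM v_x]]|/existsPn no_x] := boolP [exists v, (v \in M) && is_x v]; last first.
  rewrite big1 ?betaR_fuel_ge0 // => v vM.
  by have := no_x v; rewrite vM /= => /negPf ->.
apply: betaR_fuel_ge => // F hF.
(* Both receivers are the same x-vertex [v]: a set free for it contains no x-vertex and so has price
   0. *)
apply: (family_value_dual (A6 l) _ _ _ _ v v) => // S S0 SM.
have IHS := IHn S S0 (leq_trans (proper_card SM) Mn).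
have [SA|_] := boolP (S \subset A6 l v); last by rewrite /=; lra.
rewrite big1 /= => [|w /(subsetP SA)]; first by lra.
move: v_x; rewrite /is_x; case: (vertexP v) => [i|i|]; rewrite ?eqxx ?andbF //=; last by lia.
case: (vertexP w) => [j|j|] /=; rewrite ?in_A6E ?eqxx ?andbF //.
by have -> : odd (2 * j + 1) by lia.
Qed.

(** The two receivers depend on the y-vertices in [M]: two of them if possible; with a single y_a,
    the pair y_a, x_a, where x_a knows at most z inside [M]. Without y-vertices, counting the
    x-vertices suffices. *)
Lemma price_le_betaR n M : M != set0 -> (#|M| <= n)%N ->
  \sum_(v in M) price v <= beta n M.
Proof.
have price01 v : 0 <= price v <= 1 by rewrite /price; case: ifP => _; lra.
have px i : price (vx i) = 2^-1 by rewrite /price /=; case: ifP => //; lia.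
have pz : price vz = 2^-1 by rewrite /price /=; case: ifP => //; lia.
elim: n M => [|n IHn] M M0 Mn; first by rewrite -cards_eq0 -leqn0 Mn in M0.
have [M1|M2] := leqP #|M| 1.
  rewrite betaR_fuel_card_le1 //; have /cards1P[v ->] : #|M| == 1%N.
    by rewrite eqn_leq M1 card_gt0.
  by rewrite big_set1; case/andP: (price01 v).
have {}IHn S : S != set0 -> S \proper M -> \sum_(e in S) price e <= beta n S.
  by move=> S0 SM; apply: IHn => //; apply: leq_trans (proper_card SM) Mn.
have [/existsP[a aM]|/existsPn no_y] := boolP [exists i, vy i \in M].
  have A_y i e : e \in M -> e \in A6 l (vy i) -> e = vx i by rewrite A6y inE => _ /eqP.
  have [/existsP[b /andP[ba bM]]|/existsPn no_y] :=
      boolP [exists i, (i != a) && (vy i \in M)].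
    apply: (betaR_fuel_dual_half (A6 l) n M price (vy a) (vy b) (vx a) (vx b)
      M2 price01 aM bM _ (px _) (px _) (A_y a) (A_y b) IHn).
    by rewrite vertex_neqE eq_sym.
  have [xM|xM] := boolP (vx a \in M).
    apply: (betaR_fuel_dual_half (A6 l) n M price (vy a) (vx a) (vx a) vz
      M2 price01 aM xM _ (px _) pz (A_y a) _ IHn); first by rewrite vertex_neqE.
    move=> e; case: (vertexP e) => [i|i|] //; rewrite in_A6E // => iM ia.
    by have := no_y i; rewrite ia iM.
  (* Inside [M], y_a knows nothing, so it serves as both receivers and the conditions on [vx a] and
     [vz] hold vacuously. *)
  apply: (betaR_fuel_dual_half (A6 l) n M price (vy a) (vy a) (vx a) vz
    M2 price01 aM aM _ (px _) pz (A_y a) _ IHn); first by rewrite vertex_neqE.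
  by move=> e eM /(A_y _ _ eM) ea; rewrite -ea eM in xM.
have [x xM x_neq_z] : exists2 v, v \in M & v != vz.
  apply/exists_inP; apply: contraLR M2 => /exists_inPn Mz.
  rewrite -leqNgt; apply: leq_trans (eq_leq (cards1 vz)).
  apply: subset_leq_card; apply/subsetP => v /Mz.
  by rewrite negbK inE.
apply: le_trans (card_x_le_betaR _ _ M0 Mn).
(* Each x-vertex counts 1 against a price of 1/2; the surplus of the single vertex [x] pays for
   z. *)
have price_le v : v \in M -> v != vz -> price v + 2^-1 <= (is_x v)%:R.
  case: (vertexP v) => [i|i|] vM; rewrite ?eqxx // /is_x => ->.
    by rewrite px (_ : ~~ odd _) /=; [lra|lia].
  by have := no_y i; rewrite vM.
have [zM|zM] := boolP (vz \in M).
  rewrite (bigD1 vz) //= [leRHS](bigD1 vz) //= (bigD1 x) ?xM //= [X in _ <= _ + X](bigD1 x) ?xM //=.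
  have := price_le x xM x_neq_z; rewrite pz /is_x eqxx andbF /=.
  suff: \sum_(v | (v \in M) && (v != vz) && (v != x)) price v <=
        \sum_(v | (v \in M) && (v != vz) && (v != x)) (is_x v)%:R by rewrite /is_x; lra.
  by apply: ler_sum => v /andP[/andP[vM /(price_le _ vM) ?] _]; lra.
apply: ler_sum => v vM; have := price_le v vM; rewrite (contraNneq _ zM) => [/(_ isT)|<- //].
lra.
Qed.

(** This is 2l + (2l+1)/2; raising l by one appends two odd and two even ordinals, of total price
    3. *)
Lemma sum_price : \sum_v price v = 3 * l%:R + 2^-1.
Proof.
rewrite -(big_mkord predT (fun k => if odd k then 1 else 2^-1 : R)).
elim: l => [|k IHk]; first by rewrite big_nat1 /=; lra.
have -> : (4 * k.+1 + 1 = (4 * k + 1).+4)%N by lia.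
rewrite !big_nat_recr //= IHk -[k.+1]addn1 natrD.
have -> : odd (4 * k + 1) by lia.
by rewrite /=; lra.
Qed.

(** * Upper bound on the recursive value *)

Definition four_cycle i j := vx i |: (vy i |: (vx j |: [set vy j])).

(** Each vertex knows the next one on the cycle x_i, y_j, x_j, y_i, so the cost is at most 4 - 1.
    One unit of fuel is enough, since singletons have value 1 at any fuel. *)
Lemma betaR_four_cycle n i j : i != j -> beta n.+1 (four_cycle i j) <= 3.
Proof.
move=> ij; have card4 : #|four_cycle i j| = 4%N.
  by rewrite /four_cycle !cardsU1 cards1 !inE !vertex_neqE ?(eq_sym j) (negPf ij).
apply: le_trans (betaR_fuel_le_pred _ _ _ _ _) _; rewrite ?card4 //; last by lra.
move=> v; rewrite !inE => /or4P[] /eqP ->.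
- by exists (vy j); rewrite ?in_A6E ?inE ?eqxx ?orbT // eq_sym.
- by exists (vx i); rewrite ?in_A6E ?inE ?eqxx ?orbT.
- by exists (vy i); rewrite ?in_A6E ?inE ?eqxx ?orbT.
- by exists (vx j); rewrite ?in_A6E ?inE ?eqxx ?orbT.
Qed.

Lemma betaR_edge_xz n i : beta n.+1 [set vx i; vz] <= 1.
Proof.
have card2 : #|[set vx i; vz]| = 2%N by rewrite cards2 vertex_neqE.
apply: le_trans (betaR_fuel_le_pred _ _ _ _ _) _; rewrite ?card2 //; last by lra.
move=> v; rewrite !inE => /orP[] /eqP ->.
- by exists vz; rewrite ?in_A6E ?inE ?eqxx ?orbT.
- by exists (vx i); rewrite ?in_A6E ?inE ?eqxx ?orbT.
Qed.

Fact lo_subproof (k : 'I_l) : (2 * k < 2 * l)%N. Proof. by have := ltn_ord k; lia. Qed.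
Fact hi_subproof (k : 'I_l) : (2 * k + 1 < 2 * l)%N.
Proof. by have := ltn_ord k; lia. Qed.
Definition lo k := Ordinal (lo_subproof k).
Definition hi k := Ordinal (hi_subproof k).

Definition block k := four_cycle (lo k) (hi k).

Lemma lo_neq_hi k k' : lo k != hi k'.
Proof. by rewrite -val_eqE /=; lia. Qed.

Lemma in_block v : v != vz -> exists k, v \in block k.
Proof.
have lohi i : exists k, i = lo k \/ i = hi k.
  have hk : (i./2 < l)%N by have := ltn_ord i; lia.
  exists (Ordinal hk); have [io|io] := boolP (odd i); [right|left]; apply: val_inj => /=; lia.
case: (vertexP v) => [i|i|]; last by rewrite eqxx.
  by have [k [] ->] := lohi i; exists k; rewrite !inE eqxx ?orbT.
by have [k [] ->] := lohi i; exists k; rewrite !inE eqxx ?orbT.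
Qed.

Lemma vz_notin_block k : vz \notin block k.
Proof. by rewrite !inE !vertex_neqE. Qed.

(** Each of the five vertices lies in exactly two sets of weight 1/2. The cost is at most
    (1+1+3+1+1)/2 = 7/2, the total price of the block and z. *)
Definition half_family k : seq ({set 'I_(4 * l + 1)} * R) :=
  [:: ([set vx (lo k); vz], 2^-1); ([set vx (hi k); vz], 2^-1); (block k, 2^-1);
      ([set vy (lo k)], 2^-1); ([set vy (hi k)], 2^-1)].

Definition block_family k0 : seq ({set 'I_(4 * l + 1)} * R) :=
  half_family k0 ++ [seq (block k, 1) | k <- enum 'I_l & k != k0].

Lemma half_family_cover k v : v \in vz |: block k ->
  \sum_(p <- half_family k | v \in p.1) p.2 = 1.
Proof.
rewrite !inE => v_in.
have hilo : (hi k == lo k) = false by rewrite eq_sym (negPf (lo_neq_hi k k)).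
have lohi := negPf (lo_neq_hi k k).
rewrite /half_family !big_cons big_nil /= !inE.
case/or4P: v_in => [/eqP ->|/eqP ->|/eqP ->|/orP[] /eqP ->];
  rewrite ?vertex_neqE ?eqxx ?hilo ?lohi /=; lra.
Qed.

Lemma valid_block_family k0 : valid_family [set: 'I_(4 * l + 1)] (block_family k0).
Proof.
have half01 : 0 <= (2^-1 : R) <= 1 by lra.
have properT (S : {set 'I_(4 * l + 1)}) v : v \notin S -> S \proper [set: _].
  by move=> vS; apply/properP; split; [apply: subsetT|exists v].
have nonempty (S : {set 'I_(4 * l + 1)}) v : v \in S -> S != set0.
  by move=> vS; apply/set0Pn; exists v.
split=> [p|v _].
  rewrite mem_cat => /orP[|/mapP[k _ ->]] /=; last first.
    split; last by rewrite ler01 lexx.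
      by apply: (nonempty _ (vx (lo k))); rewrite !inE eqxx.
    exact: properT (vz_notin_block k).
  rewrite !inE => /or4P[/eqP ->|/eqP ->|/eqP ->|/orP[] /eqP ->] /=; split=> //.
  - by apply: (nonempty _ vz); rewrite !inE eqxx orbT.
  - by apply: (properT _ (vy (lo k0))); rewrite !inE !vertex_neqE.
  - by apply: (nonempty _ vz); rewrite !inE eqxx orbT.
  - by apply: (properT _ (vy (lo k0))); rewrite !inE !vertex_neqE.
  - by apply: (nonempty _ (vx (lo k0))); rewrite !inE eqxx.
  - exact: properT (vz_notin_block k0).
  - by apply: (nonempty _ (vy (lo k0))); rewrite !inE eqxx.
  - by apply: (properT _ vz); rewrite !inE !vertex_neqE.
  - by apply: (nonempty _ (vy (hi k0))); rewrite !inE eqxx.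
  - by apply: (properT _ vz); rewrite !inE !vertex_neqE.
rewrite big_cat /=; have [v_in|] := boolP (v \in vz |: block k0).
  by rewrite half_family_cover // big_map lerDl sumr_ge0.
rewrite in_setU1 negb_or => /andP[v_neq_z v_notin].
have [k vk] := in_block _ v_neq_z.
have kk0 : k != k0 by apply: contraNneq v_notin => <-.
rewrite big_map big_filter_cond big_enum_cond /= (bigD1 k) /=; last by rewrite kk0.
rewrite addrCA lerDl addr_ge0 //; last by rewrite sumr_ge0.
rewrite big_seq_cond sumr_ge0 // => p /andP[+ _].
by rewrite !inE => /or4P[/eqP ->|/eqP ->|/eqP ->|/orP[] /eqP ->] /=; case/andP: half01.
Qed.

Lemma betaR_instance_A6 : (0 < l)%N -> betaR_instance (A6 l) R = 3 * l%:R + 2^-1.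
Proof.
move=> l_gt0; rewrite /betaR_instance /betaR.
(* The double successor leaves positive fuel for the blocks and edges after one unfolding. *)
have cardT : #|[set: 'I_(4 * l + 1)]| = (4 * l).-1.+2 by rewrite cardsT card_ord; lia.
apply/eqP; rewrite eq_le -{2}sum_price; apply/andP; split; last first.
  apply: le_trans (price_le_betaR _ [set: 'I_(4 * l + 1)] _ (leqnn _)).
    by rewrite le_eqVlt; apply/orP; left; apply/eqP/eq_bigl => v; rewrite inE.
  by rewrite -card_gt0 cardT.
pose k0 := Ordinal l_gt0; rewrite cardT.
apply: le_trans (betaR_fuel_le_total (A6 l) _ _ _ _ (valid_block_family k0)) _.
  by rewrite cardT.
set b := beta (4 * l).-1.+1.
have b_block k : b (block k) <= 3 by apply/betaR_four_cycle/lo_neq_hi.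
have b_edge i : b [set vx i; vz] <= 1 by apply: betaR_edge_xz.
have b_single v : b [set v] = 1 by apply: betaR_fuel_card_le1; rewrite cards1.
rewrite big_cat /= big_map big_filter big_enum_cond /=.
have blocks_le : \sum_(k < l | k != k0) 1 * b (block k) <= 3 * (l%:R - 1).
  apply: (@le_trans _ _ (\sum_(k < l | k != k0) 3)).
    by apply: ler_sum => k _; rewrite mul1r.
  rewrite sumr_const -[leLHS]mulr_natr ler_pM2l // cardC1 card_ord.
  by rewrite -subn1 natrB.
rewrite !big_cons big_nil /= !b_single.
(* The total is at most 3(l-1) + 7/2 = 3l + 1/2. *)
have := b_block k0; have := b_edge (lo k0); have := b_edge (hi k0).
lra.
Qed.

End InstanceI6.

Theorem theorem4 (R : realType) (l : nat) (hl : (1 <= l)%N) :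
  (exists ws, UMCD_execution (A6 l) ws) /\
  (forall ws : seq 'I_(4 * l + 1), UMCD_execution (A6 l) ws ->
     betaR_instance (A6 l) R - (size ws)%:R = l%:R - 1 / 2).
Proof.
(* An execution exists, so the claim about all executions is not vacuous. *)
split=> [|ws /(UMCD_A6_size _ hl) ->]; first exact: umcd_run_exists.
by rewrite betaR_instance_A6 // natrD natrM; lra.
Qed.
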